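(* Let $p\in[0,1]$. Consider the complemented stochastic six vertex (CS6V) model on $\mathbb{Z}_{\ge1}^2$ with empty boundary data and constant parameters $b_1(i,j)=0$ and $b_2(i,j)=1-p$ for all $i,j$. Then the CS6V model degenerates to the discrete Hammersley process with parameter $p$: the random collection of lines of the CS6V model (i.e. the random set of occupied edges) has the same distribution as the random collection of level lines of the discrete Hammersley process. In particular, the height functions $\{H(x,y)\}_{x,y\in\mathbb{Z}_{\ge0}}$ and $\{H^{\mathsf d}(x,y)\}_{x,y\in\mathbb{Z}_{\ge0}}$ have the same distribution.
   Context: CS6V model with empty boundary data. The vertex set is $\mathbb{Z}_{\ge1}^2$. Each vertex $(i,j)$ has two input edges (bottom and left) and two output edges (top and right); the top edge of $(i,j)$ is the bottom edge of $(i,j+1)$ and the right edge of $(i,j)$ is the left edge of $(i+1,j)$. Each edge carries $0$ or $1$ line. No line enters from the left edges of $(1,j)$ or the bottom edges of $(i,1)$. The vertices are processed sequentially in the order $(1,1),(2,1),(1,2),(3,1),(2,2),(1,3),\dots$. At vertex $(i,j)$, given its inputs, the outputs are sampled (conditionally independently of everything sampled before) as follows: only the bottom input occupied: only the top output is occupied with probability $1$; only the left input occupied: only the right output is occupied with probability $1$; both inputs occupied: both outputs occupied with probability $b_1(i,j)$, none with probability $1-b_1(i,j)$; no input occupied: no output occupied with probability $b_2(i,j)$, both outputs occupied with probability $1-b_2(i,j)$. The height function is $H(x,y)=\#\{z\in\{1,\dots,x\}: \text{the top output edge of }(z,y)\text{ is occupied}\}$ for $y\ge1$, and $H(x,0)=0$.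 Discrete Hammersley process. Let $\xi\subseteq\mathbb{Z}_{\ge1}^2$ be random, each point belonging to $\xi$ independently with probability $p$. Write $(x_1,y_1)\prec(x_2,y_2)$ iff $x_1<x_2$ and $y_1<y_2$. Define $$H^{\mathsf d}(x,y)=\max\{L: \text{there exist integer points }(x_1,y_1)\prec\dots\prec(x_L,y_L)\text{ in }\xi\cap[1,x]\times[1,y]\}$$ (with value $0$ if there is no such point). Level lines: connect by a down-right path the minimal points of $\xi$ with respect to $\prec$ (the path is the boundary of the union of the quadrants $(a,b)+\mathbb{R}_{\ge0}^2$ over these minimal points $(a,b)$); remove these points from $\xi$, connect the new minimal points in the same way to obtain the second line, and so on. When one crosses a line from southwest to northeast the height increases by $1$. In terms of edges: the top edge of $(i,j)$ is on a level line iff $H^{\mathsf d}(i,j)-H^{\mathsf d}(i-1,j)=1$, and the right edge of $(i,j)$ is on a level line iff $H^{\mathsf d}(i,j)-H^{\mathsf d}(i,j-1)=1$. *)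

(* Defs.v *)
From HB Require Import structures.
From mathcomp Require Import all_boot all_order all_algebra.
From mathcomp Require Import all_classical all_reals all_analysis.

Set Implicit Arguments.
Unset Strict Implicit.
Unset Printing Implicit Defensive.

Import Order.TTheory GRing.Theory Num.Theory.
Import numFieldNormedType.Exports.

Local Open Scope classical_set_scope.
Local Open Scope ring_scope.

(* The space of families [I -> V], with the product sigma-algebra, that is the
   sigma-algebra generated by the coordinate maps. *)
Definition product_space (I : Type) d (V : measurableType d) :=
  g_sigma_algebraType (\bigcup_(i in [set: I])
    preimage_set_system [set: I -> V] (fun f : I -> V => f i) measurable).

Definition same_distribution d d' d0 (R : realType)
    (Omega : measurableType d) (P : probability Omega R)
    (Omega' : measurableType d') (P' : probability Omega' R)
    (E : measurableType d0) (X : Omega -> E) (Y : Omega' -> E) : Prop :=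
  [/\ measurable_fun [set: Omega] X, measurable_fun [set: Omega'] Y &
      forall A : set E, measurable A -> pushforward P X A = pushforward P' Y A].

(* [TopEdge i j] and [RightEdge i j] are the output edges of the lattice point
   (i, j): the unit segments from (i, j) to (i, j + 1) and to (i + 1, j).  For
   a vertex (i, j), 1 <= i, 1 <= j, the bottom and left inputs are
   [TopEdge i j.-1] and [RightEdge i.-1 j]. *)
Variant edge := TopEdge of nat & nat | RightEdge of nat & nat.

(* [TopEdge i 0] (resp. [RightEdge 0 j]) is an entrance edge at the bottom
   (resp. on the left).  [TopEdge 0 j] and [RightEdge i 0] do not belong to
   the model; they are unoccupied by convention. *)
Definition empty_boundary (c : edge -> bool) : Prop :=
  forall i j, (i == 0)%N || (j == 0)%N ->
    c (TopEdge i j) = false /\ c (RightEdge i j) = false.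

(* (1,1), (2,1), (1,2), (3,1), (2,2), (1,3), ... *)
Definition processed_before (u v : nat * nat) : bool :=
  ((u.1 + u.2 < v.1 + v.2) || (u.1 + u.2 == v.1 + v.2) && (u.2 < v.2))%N.

Definition cs6v_weight (R : realType) (b1 b2 : R)
    (bottom left top right : bool) : R :=
  match bottom, left with
  | true, false => (top && ~~ right)%:R
  | false, true => (~~ top && right)%:R
  | true, true =>
      if top && right then b1 else if ~~ top && ~~ right then 1 - b1 else 0
  | false, false =>
      if ~~ top && ~~ right then b2 else if top && right then 1 - b2 else 0
  end.

Definition past_event (Omega : Type) (X : Omega -> edge -> bool)
    (i j : nat) (c : edge -> bool) : set Omega :=
  [set w | forall i' j', (1 <= i')%N -> (1 <= j')%N ->
     processed_before (i', j') (i, j) ->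
     X w (TopEdge i' j') = c (TopEdge i' j') /\
     X w (RightEdge i' j') = c (RightEdge i' j')].

Definition output_event (Omega : Type) (X : Omega -> edge -> bool)
    (i j : nat) (top right : bool) : set Omega :=
  [set w | X w (TopEdge i j) = top /\ X w (RightEdge i j) = right].

(* The conditional law of the outputs of (i, j), given everything sampled
   before, is the vertex weight of the inputs of (i, j).  The past is a finite
   configuration, so conditioning is elementary; it is written as a product to
   allow pasts of probability 0. *)
Definition cs6v (R : realType) d (Omega : measurableType d)
    (P : probability Omega R) (b1 b2 : nat -> nat -> R)
    (X : Omega -> edge -> bool) : Prop :=
  [/\ forall e, measurable [set w | X w e],
      forall w, empty_boundary (X w) &
      forall i j, (1 <= i)%N -> (1 <= j)%N ->
      forall c, empty_boundary c -> forall top right : bool,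
        (P (past_event X i j c `&` output_event X i j top right) =
         P (past_event X i j c) *
           (cs6v_weight (b1 i j) (b2 i j)
              (c (TopEdge i j.-1)) (c (RightEdge i.-1 j)) top right)%:E)%E].

Definition cs6v_height (c : edge -> bool) (v : nat * nat) : nat :=
  if v.2 == 0%N then 0%N
  else (\sum_(1 <= z < v.1.+1) c (TopEdge z v.2))%N.

Definition mutually_independent (R : realType) d (Omega : measurableType d)
    (P : probability Omega R) (I : eqType) (D : set I) (A : I -> set Omega)
    : Prop :=
  forall s : seq I, uniq s -> [set` s] `<=` D ->
    P (\bigcap_(i in [set` s]) A i) = (\prod_(i <- s) P (A i))%E.

Definition positive_quadrant : set (nat * nat) :=
  [set v | (1 <= v.1)%N /\ (1 <= v.2)%N].

Definition bernoulli_field (R : realType) d (Omega : measurableType d)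
    (P : probability Omega R) (p : R) (xi : Omega -> set (nat * nat)) : Prop :=
  [/\ forall w, xi w `<=` positive_quadrant,
      forall v, positive_quadrant v ->
        measurable [set w | xi w v] /\ P [set w | xi w v] = p%:E &
      mutually_independent P positive_quadrant
        (fun v => [set w | xi w v])].

Definition prec (u v : nat * nat) : bool := ((u.1 < v.1) && (u.2 < v.2))%N.

Definition chain (xi : set (nat * nat)) (x y : nat) (s : seq (nat * nat))
    : Prop :=
  sorted prec s /\
  forall v, v \in s -> [/\ xi v, (1 <= v.1 <= x)%N & (1 <= v.2 <= y)%N].

(* The bound on the range of [L] is harmless: see [hammersley_heightP]. *)
Definition hammersley_height (xi : set (nat * nat)) (v : nat * nat) : nat :=
  (\max_(L < v.1.+1 | `[< exists2 s, chain xi v.1 v.2 s & size s = L >]) L)%N.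

Lemma chain_size (xi : set (nat * nat)) (x y : nat) (s : seq (nat * nat)) :
  chain xi x y s -> (size s <= x)%N.
Proof.
move=> [srt mem_s].
have srt1 : sorted ltn (map fst s).
  by rewrite sorted_map; apply: sub_sorted srt => u v /andP[].
rewrite -(size_map fst) -[leqRHS](size_iota 1).
apply: uniq_leq_size; first exact: (sorted_uniq ltn_trans ltnn srt1).
move=> _ /mapP[v /mem_s[_ v1 _] ->].
by rewrite mem_iota add1n ltnS.
Qed.

Lemma hammersley_heightP (xi : set (nat * nat)) (x y : nat) :
  (exists2 s, chain xi x y s & size s = hammersley_height xi (x, y)) /\
  (forall s, chain xi x y s -> (size s <= hammersley_height xi (x, y))%N).
Proof.
split.
  rewrite /hammersley_height /=.
  have [|L /asboolP LP ->] := @eq_bigmax_cond _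
    [pred L : 'I_x.+1 | `[< exists2 s, chain xi x y s & size s = L >]]
    (@nat_of_ord x.+1).
    apply/card_gt0P; exists ord0; apply/asboolP.
    by exists [::] => //; split.
  exact: LP.
move=> s cs; rewrite /hammersley_height /=.
have sx : (size s < x.+1)%N by rewrite ltnS; exact: chain_size cs.
apply: (@leq_bigmax_cond _ _ (@nat_of_ord x.+1) (Ordinal sx)).
by apply/asboolP; exists s.
Qed.

Definition minimal_points (A : set (nat * nat)) : set (nat * nat) :=
  [set v | A v /\ forall u, A u -> ~~ prec u v].

Definition remove_minimal (A : set (nat * nat)) : set (nat * nat) :=
  A `\` minimal_points A.

Definition quadrant (R : realType) (a : nat * nat) : set (R * R) :=
  [set z | a.1%:R <= z.1 /\ a.2%:R <= z.2].

Definition boundary (T : topologicalType) (A : set T) : set T :=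
  closure A `\` A°.

(* The level lines are numbered from 0. *)
Definition level_line (R : realType) (xi : set (nat * nat)) (n : nat)
    : set (R * R) :=
  boundary (\bigcup_(a in minimal_points (iter n remove_minimal xi))
              quadrant a).

Definition edge_segment (R : realType) (e : edge) : set (R * R) :=
  match e with
  | TopEdge i j => [set z | z.1 = i%:R /\ j%:R <= z.2 <= j.+1%:R]
  | RightEdge i j => [set z | i%:R <= z.1 <= i.+1%:R /\ z.2 = j%:R]
  end.

Definition level_line_edges (R : realType) (xi : set (nat * nat)) (e : edge)
    : bool :=
  `[< exists n, @edge_segment R e `<=` level_line xi n >].

(* Main.v *)
Require Import Defs.
From HB Require Import structures.
From mathcomp Require Import all_boot all_order all_algebra.
From mathcomp Require Import all_classical all_reals all_analysis.
From mathcomp Require Import lra zify.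

Set Implicit Arguments.
Unset Strict Implicit.
Unset Printing Implicit Defensive.

Import Order.TTheory GRing.Theory Num.Theory.
Import numFieldNormedType.Exports.

Local Open Scope classical_set_scope.
Local Open Scope ring_scope.

(** Crossing a vertex (i, j), the height h of the Hammersley process obeys
<<
  h(i, j) = max (h(i-1, j), h(i, j-1), h(i-1, j-1) + 1_{(i, j) in xi}),
>>
    because a longest chain of the box [1, i] x [1, j] either ends at (i, j) or
    fits in one of the two smaller boxes ([heightSS]).  All the increments of h
    across a lattice edge are 0 or 1, and an edge lies on a level line exactly
    when the increment across it is 1 ([level_line_edges_top],
    [level_line_edges_right]): the n-th line, counted from 0, is the boundary of
    the region h > n ([level_lineP]), since peeling off n times the minimal
    points of xi leaves the points of height more than n
    ([iter_remove_minimal]).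

    Read on the edges, the recursion is a vertex rule
    ([level_line_edges_vertex]).  A single incoming line goes straight on, two
    incoming lines annihilate, and out of a vertex without incoming line comes a
    pair of lines if the vertex is in xi and nothing otherwise.  These are the
    CS6V weights for b1 = 0 and b2 = 1 - p, where the randomness of a vertex is
    the event that it is in xi.  What was processed before (i, j) is a function of xi away
    from (i, j), hence independent of that event ([past_off_vertex],
    [bernoulli_independent]); so the edges of the level lines form a CS6V model
    ([hammersley_cs6v]).

    The law of a CS6V model is determined by its weights ([cs6v_unique]): the
    vertices are processed one after the other, so the probability of a finite
    past is a product of weights, and finitely many edges always lie in a finite
    past.  This gives the equality in law of the edges.  The height is the same
    measurable function of the edges in both models
    ([cs6v_height_level_lines], [measurable_cs6v_height]), whence the second
    equality in law. *)

(** * Heights of the Hammersley process *)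

Lemma prec_trans : transitive prec.
Proof.
move=> v u w /andP[uv1 uv2] /andP[vw1 vw2].
by rewrite /prec (ltn_trans uv1 vw1) (ltn_trans uv2 vw2).
Qed.

Lemma le_chain_height (xi : set (nat * nat)) (x y : nat) (s : seq (nat * nat)) :
  chain xi x y s -> (size s <= hammersley_height xi (x, y))%N.
Proof. exact: (hammersley_heightP xi x y).2. Qed.

Lemma height_chain (xi : set (nat * nat)) (x y : nat) :
  exists2 s, chain xi x y s & size s = hammersley_height xi (x, y).
Proof. exact: (hammersley_heightP xi x y).1. Qed.

Lemma chain_rcons (xi : set (nat * nat)) (x y : nat) (s : seq (nat * nat)) u :
  chain xi x y s -> xi u -> (x < u.1)%N -> (y < u.2)%N ->
  chain xi u.1 u.2 (rcons s u).
Proof.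
move=> [srt mem_s] xiu xu yu; split.
  case: s srt mem_s => //= a s srt mem_s.
  rewrite rcons_path srt /=.
  have [_ /andP[_ l1] /andP[_ l2]] := mem_s _ (mem_last a s).
  by rewrite /prec (leq_ltn_trans l1 xu) (leq_ltn_trans l2 yu).
move=> v; rewrite mem_rcons inE
  => /predU1P[->|/mem_s[? /andP[-> vx] /andP[-> vy]]].
  by rewrite !leqnn (leq_ltn_trans _ xu) // (leq_ltn_trans _ yu).
by rewrite (leq_trans vx (ltnW xu)) (leq_trans vy (ltnW yu)).
Qed.

Lemma chain_rconsK (xi : set (nat * nat)) (x y : nat) (s : seq (nat * nat)) u :
  chain xi x y (rcons s u) ->
  [/\ chain xi u.1.-1 u.2.-1 s, xi u, (1 <= u.1 <= x)%N & (1 <= u.2 <= y)%N].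
Proof.
move=> [srt mem_s].
have [xiu u1 u2] : [/\ xi u, (1 <= u.1 <= x)%N & (1 <= u.2 <= y)%N].
  by apply: mem_s; rewrite mem_rcons mem_head.
split=> //; split.
  by apply: subseq_sorted srt; [exact: prec_trans|exact: subseq_rcons].
move=> v vs.
have [xiv /andP[v1 _] /andP[v2 _]] :
    [/\ xi v, (1 <= v.1 <= x)%N & (1 <= v.2 <= y)%N].
  by apply: mem_s; rewrite mem_rcons inE vs orbT.
have /andP[uv1 uv2] : prec v u.
  have : sorted prec (rcons s u) by [].
  rewrite sorted_pairwise; last exact: prec_trans.
  rewrite -cats1 pairwise_cat => /and3P[/allrelP + _ _].
  by apply => //; rewrite mem_head.
rewrite v1 v2 /=.
by rewrite -ltnS (leq_trans uv1 (leqSpred _)) -ltnS (leq_trans uv2 (leqSpred _)).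
Qed.

Lemma leq_height (xi : set (nat * nat)) (x x' y y' : nat) :
  (x <= x')%N -> (y <= y')%N ->
  (hammersley_height xi (x, y) <= hammersley_height xi (x', y'))%N.
Proof.
move=> xx' yy'; have [s [srt mem_s] <-] := height_chain xi x y.
apply: le_chain_height; split=> // v /mem_s[? /andP[-> vx] /andP[-> vy]].
by rewrite (leq_trans vx xx') (leq_trans vy yy').
Qed.

Lemma height0l (xi : set (nat * nat)) y : hammersley_height xi (0, y) = 0%N.
Proof.
have [[|v s] [_ mem_s] <- //] := height_chain xi 0 y.
by have [_ /andP[v0 /(leq_trans v0)]] := mem_s v (mem_head _ _).
Qed.

Lemma height0r (xi : set (nat * nat)) x : hammersley_height xi (x, 0) = 0%N.
Proof.
have [[|v s] [_ mem_s] <- //] := height_chain xi x 0.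
by have [_ _ /andP[v0 /(leq_trans v0)]] := mem_s v (mem_head _ _).
Qed.

(** Deleting the last point of a chain leaves a chain in the smaller box.
    Together with monotonicity this bounds all the increments by 1. *)
Lemma height_diag (xi : set (nat * nat)) x y :
  (hammersley_height xi (x, y) <= (hammersley_height xi (x.-1, y.-1)).+1)%N.
Proof.
have [s cs <-] := height_chain xi x y.
case/lastP: s cs => // s u /chain_rconsK[[srt mem_s] _ /andP[_ ux] /andP[_ uy]].
rewrite size_rcons ltnS; apply: le_chain_height; split=> // v /mem_s[xiv].
move=> /andP[-> v1] /andP[-> v2]; split => //=.
  by rewrite (leq_trans v1) // -!subn1 leq_sub2r.
by rewrite (leq_trans v2) // -!subn1 leq_sub2r.
Qed.

(** A longest chain strictly below a point of the field can be extended by that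
    point. *)
Lemma height_point (xi : set (nat * nat)) (x y : nat) u :
  xi u -> (1 <= u.1 <= x)%N -> (1 <= u.2 <= y)%N ->
  (hammersley_height xi (u.1.-1, u.2.-1) < hammersley_height xi (x, y))%N.
Proof.
move=> xiu /andP[u1 ux] /andP[u2 uy].
have [s cs <-] := height_chain xi u.1.-1 u.2.-1.
rewrite -(size_rcons s u).
have cu : chain xi u.1 u.2 (rcons s u).
  by apply: chain_rcons cs xiu _ _; rewrite prednK.
exact: leq_trans (le_chain_height cu) (leq_height _ ux uy).
Qed.

(** The last point of a longest chain is the corner of the box, or it misses
    the last column or the last row, and then so does the whole chain. *)
Lemma heightSS (xi : set (nat * nat)) (i j : nat) :
  hammersley_height xi (i.+1, j.+1) =
  maxn (maxn (hammersley_height xi (i, j.+1)) (hammersley_height xi (i.+1, j)))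
       (hammersley_height xi (i, j) + `[< xi (i.+1, j.+1) >])%N.
Proof.
apply/eqP; rewrite eqn_leq !geq_max !leq_height //=; apply/andP; split.
  have [s cs <-] := height_chain xi i.+1 j.+1.
  case/lastP: s cs => // s [a b] /[dup] cs.
  move=> /chain_rconsK/=[cs' xiu /andP[a1 ai] /andP[b1 bj]].
  rewrite size_rcons !leq_max.
  have le_s x y : (a <= x)%N -> (b <= y)%N ->
      (size s < hammersley_height xi (x, y))%N.
    move=> ax yb; apply: leq_ltn_trans (@height_point _ x y (a, b) xiu _ _) => /=.
    - exact: le_chain_height.
    - by rewrite a1.
    - by rewrite b1.
  move: ai; rewrite leq_eqVlt ltnS => /predU1P[ai|ai]; last by rewrite le_s.
  move: bj; rewrite leq_eqVlt ltnS => /predU1P[bj|bj]; last first.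
    by rewrite [X in _ || X || _]le_s ?ai ?orbT // -ai.
  move: xiu cs'; rewrite ai bj => /asboolT -> /le_chain_height/= hs.
  by rewrite addn1 !ltnS hs !orbT.
case: asboolP => xiv; last by rewrite addn0 leq_height.
by rewrite addn1; apply: (@height_point _ _ _ (i.+1, j.+1) xiv) => /=; rewrite leqnn.
Qed.

(** The height of a corner only sees its box; this is where the independence of
    a vertex from its past comes from. *)
Lemma eq_height (xi xi' : set (nat * nat)) (x y : nat) :
  (forall v, (v.1 <= x)%N -> (v.2 <= y)%N -> xi v <-> xi' v) ->
  hammersley_height xi (x, y) = hammersley_height xi' (x, y).
Proof.
move=> exi; have lexi xi1 xi2 :
    (forall v, (v.1 <= x)%N -> (v.2 <= y)%N -> xi1 v -> xi2 v) ->
    (hammersley_height xi1 (x, y) <= hammersley_height xi2 (x, y))%N.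
  move=> sub12; have [s [srt mem_s] <-] := height_chain xi1 x y.
  apply: le_chain_height; split=> // v /mem_s[xiv vx vy]; split=> //.
  by apply: sub12 => //; [case/andP: vx|case/andP: vy].
by apply/eqP; rewrite eqn_leq !lexi // => v v1 v2 /exi; apply.
Qed.

Lemma heightSl (xi : set (nat * nat)) i j :
  (hammersley_height xi (i, j) <= (hammersley_height xi (i.-1, j)).+1)%N.
Proof. by rewrite (leq_trans (height_diag _ _ _))// ltnS leq_height // leq_pred. Qed.

Lemma heightSr (xi : set (nat * nat)) i j :
  (hammersley_height xi (i, j) <= (hammersley_height xi (i, j.-1)).+1)%N.
Proof. by rewrite (leq_trans (height_diag _ _ _))// ltnS leq_height // leq_pred. Qed.

(** Descending along [prec] decreases the first coordinate, so it stops. *)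
Lemma minimal_points_below (A : set (nat * nat)) u : A u ->
  exists2 a, minimal_points A a & (a.1 <= u.1)%N && (a.2 <= u.2)%N.
Proof.
have [n] := ubnP u.1; elim: n u => // n IHn u; rewrite ltnS => un Au.
have [[v [Av /[dup] vu /andP[v1 v2]]]|nA] := pselect (exists v, A v /\ prec v u).
  have [a ma /andP[a1 a2]] := IHn v (leq_trans v1 un) Av.
  exists a => //.
  by rewrite (leq_trans a1 (ltnW v1)) (leq_trans a2 (ltnW v2)).
exists u; rewrite ?leqnn //; split=> // v Av; apply/negP => vu.
by apply: nA; exists v.
Qed.

(** Among the points of height more than n, the minimal ones are those of
    height n + 1: a point of height at least n + 2 is the end of a chain whose
    last but one point has height more than n. *)
Lemma iter_remove_minimal (xi : set (nat * nat)) n :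
  xi `<=` positive_quadrant ->
  iter n remove_minimal xi = [set v | xi v /\ (n < hammersley_height xi v)%N].
Proof.
move=> xi_pos; elim: n => [|n IHn].
  apply/seteqP; split=> [[a b] xiv|v []//]; split=> //=.
  have [a1 b1] := xi_pos _ xiv.
  by apply: leq_ltn_trans (@height_point _ a b _ xiv _ _); rewrite //= leqnn ?a1 ?b1.
rewrite iterS IHn; apply/seteqP; split=> [[a b] [[xiv hv] nmin]|[a b] [xiv hv]].
  split=> //; have [a1 b1] := xi_pos _ xiv.
  have [[u [[xiu hu] /andP[u1 u2]]]|nu] := pselect (exists u,
      [set v | xi v /\ (n < hammersley_height xi v)%N] u /\ prec u (a, b)).
    apply: leq_ltn_trans (@height_point _ a b _ xiv _ _);
      rewrite /= ?leqnn ?a1 ?b1 //.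
    apply: leq_trans hu _; case: u u1 u2 {xiu} => c e /= u1 u2.
    by rewrite leq_height // -ltnS prednK.
  exfalso; apply: nmin; split=> // u uA; apply/negP => uv.
  by apply: nu; exists u.
split; first by split=> //; exact: ltnW.
move=> [_ minv].
have [s cs es] := height_chain xi a.-1 b.-1.
have : (n < size s)%N.
  by rewrite es -ltnS (leq_trans hv) // height_diag.
case/lastP: s cs es => // s [c e] cs; rewrite size_rcons ltnS => es ns.
have [cs' xiu /andP[c1 ca] /andP[e1 eb]] := chain_rconsK cs.
have [a1 b1] := xi_pos _ xiv.
have /minv/negP : [set v | xi v /\ (n < hammersley_height xi v)%N] (c, e).
  split=> //=.
  apply: leq_ltn_trans (@height_point _ c e _ xiu _ _);
    rewrite /= ?leqnn ?c1 ?e1 //.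
  exact: leq_trans ns (le_chain_height cs').
apply; rewrite /prec /= -[a]prednK // -[b]prednK // !ltnS.
by rewrite ca eb.
Qed.

(** * Geometry of the level lines *)

Lemma ball_box (R : realType) (z z' : R * R) (e : R) :
  ball z e z' <-> (z.1 - e < z'.1 < z.1 + e) /\ (z.2 - e < z'.2 < z.2 + e).
Proof.
have ballE (a b : R) : ball a e b <-> (a - e < b < a + e).
  by rewrite -ball_normE /= -ltr_distl distrC.
by split=> [[/ballE ? /ballE ?]|[/ballE ? /ballE ?]]; split.
Qed.

(** The quadrants at the minimal points of height more than n cover the real
    points whose integer part has height more than n.  Their union is closed, so
    its boundary consists of its points that can be left by an arbitrarily small
    move to the south-west; the two conditions express this by the lattice
    points that bound z on either side. *)
Lemma level_lineP (R : realType) (xi : set (nat * nat)) (n : nat) (z : R * R) :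
  xi `<=` positive_quadrant -> 0 <= z.1 -> 0 <= z.2 ->
  level_line xi n z <->
  (forall i j : nat, z.1 < i.+1%:R -> z.2 < j.+1%:R ->
     (n < hammersley_height xi (i, j))%N) /\
  (forall i j : nat, i%:R < z.1 -> j%:R < z.2 ->
     (hammersley_height xi (i, j) <= n)%N).
Proof.
move=> xi_pos z1 z2.
pose A := [set v | xi v /\ (n < hammersley_height xi v)%N].
pose U : set (R * R) := \bigcup_(a in minimal_points A) @quadrant R a.
have UP (y : R * R) : U y ->
    exists a b : nat,
      [/\ a%:R <= y.1, b%:R <= y.2 & (n < hammersley_height xi (a, b))%N].
  by move=> [[a b] [[xia ha] _] [/= a1 b1]]; exists a, b.
have PU (y : R * R) (a b : nat) : a%:R <= y.1 -> b%:R <= y.2 ->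
    (n < hammersley_height xi (a, b))%N -> U y.
  move=> ay yb hab.
  have [s cs es] := height_chain xi a b.
  (* The end of a longest chain of the box lies in the region. *)
  case/lastP: s cs es => [_ es|s [c e] cs es]; first by move: hab; rewrite -es.
  have [cs' xiu /= /andP[c1 ca] /andP[e1 eb]] := chain_rconsK cs.
  have /minimal_points_below [u mu /andP[u1 u2]] : A (c, e).
    split=> //; move: hab; rewrite -es size_rcons => /leq_trans; apply.
    apply: leq_ltn_trans (le_chain_height cs') _.
    by apply: (@height_point _ c e (c, e)) => //=; rewrite leqnn ?c1 ?e1.
  exists u => //; split.
    by rewrite (le_trans _ ay) // ler_nat (leq_trans u1).
  by rewrite (le_trans _ yb) // ler_nat (leq_trans u2).
rewrite /level_line (iter_remove_minimal _ xi_pos) -/A -/U /boundary.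
have ltS (a b : nat) (x : R) : a%:R <= x -> x < b.+1%:R -> (a <= b)%N.
  by move=> ax xb; rewrite -ltnS -(ltr_nat R) (le_lt_trans ax).
split=> [[clU nint]|[inU outU]]; split.
- move=> i j zi zj.
  pose e := Num.min (i.+1%:R - z.1) (j.+1%:R - z.2).
  have e0 : 0 < e by rewrite lt_min !subr_gt0 zi.
  have [y [/UP[a [b [ay yb hab]]]]] := clU _ (nbhsx_ballx z e e0).
  move=> /ball_box[/andP[_ y1] /andP[_ y2]].
  apply: leq_trans hab _; apply: leq_height.
    apply: ltS ay _; apply: lt_le_trans y1 _.
    by rewrite -lerBrDl ge_min lexx.
  apply: ltS yb _; apply: lt_le_trans y2 _.
  by rewrite -lerBrDl ge_min lexx orbT.
- move=> i j iz jz; rewrite leqNgt; apply/negP => hij; apply: nint.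
  pose e := Num.min (z.1 - i%:R) (z.2 - j%:R).
  have e0 : 0 < e by rewrite lt_min !subr_gt0 iz.
  apply/nbhs_ballP; exists e => // y /ball_box[/andP[y1 _] /andP[y2 _]].
  apply: PU hij; rewrite ltW //.
    by apply: le_lt_trans y1; rewrite lerBrDl -lerBrDr ge_min lexx.
  by apply: le_lt_trans y2; rewrite lerBrDl -lerBrDr ge_min lexx orbT.
- apply: subset_closure.
  apply: (PU z (Num.truncn z.1) (Num.truncn z.2)).
  + by rewrite truncn_le.
  + by rewrite truncn_le.
  + by apply: inU; [case/andP: (truncn_itv z1)|case/andP: (truncn_itv z2)].
- move=> /nbhs_ballP[e e0 sub].
  have /sub/UP[a [b [/= ay yb hab]]] : ball z e (z.1 - e / 2, z.2 - e / 2).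
    by apply/ball_box; move: e0 => /= e0; split => /=; apply/andP; split; lra.
  have := outU a b; rewrite leqNgt hab /=; move: e0 => /= e0.
  by move=> H; have : false by apply: H; lra.
Qed.

Lemma level_line_edges_top (R : realType) (xi : set (nat * nat)) i j :
  xi `<=` positive_quadrant ->
  level_line_edges R xi (TopEdge i j) =
  (hammersley_height xi (i.-1, j) < hammersley_height xi (i, j))%N.
Proof.
move=> xi_pos; apply/asboolP/idP => [[n sub]|lth].
  (* At the middle of the segment, the neighbouring lattice points that the
     characterization provides are the two sides of the edge. *)
  pose z : R * R := (i%:R, j%:R + 2^-1).
  have lz : level_line xi n z.
    by apply: sub => /=; split=> //; rewrite -(natr1 j); apply/andP; split; lra.
  have z1 : 0 <= z.1 by [].
  have z2 : 0 <= z.2 by rewrite addr_ge0.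
  move: lz => /(level_lineP _ xi_pos z1 z2)/=[/(_ i j) ge /(_ i.-1 j) le].
  apply: leq_ltn_trans (ge _ _).
  - case: i le {sub ge z z1 z2} => [|i] le; first by rewrite height0l.
    by apply: le; rewrite ?ltr_nat // ltrDl.
  - by rewrite ltr_nat.
  - by rewrite -(natr1 j) ltrD2l; lra.
case: i lth => [|i] lth; first by rewrite ltnn in lth.
exists (hammersley_height xi (i, j)) => -[x y] /= [-> /andP[jy yj]].
apply/level_lineP => //=; first exact: le_trans jy.
split=> i' j'; rewrite ltr_nat ltnS => ii' yj'.
  apply: leq_trans lth _; apply: leq_height => //.
  by rewrite -ltnS -(ltr_nat R) (le_lt_trans jy).
by apply: leq_height => //; rewrite -ltnS -(ltr_nat R) (lt_le_trans yj').
Qed.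

Lemma level_line_edges_right (R : realType) (xi : set (nat * nat)) i j :
  xi `<=` positive_quadrant ->
  level_line_edges R xi (RightEdge i j) =
  (hammersley_height xi (i, j.-1) < hammersley_height xi (i, j))%N.
Proof.
move=> xi_pos; apply/asboolP/idP => [[n sub]|lth].
  pose z : R * R := (i%:R + 2^-1, j%:R).
  have lz : level_line xi n z.
    by apply: sub => /=; split=> //; rewrite -(natr1 i); apply/andP; split; lra.
  have z1 : 0 <= z.1 by rewrite addr_ge0.
  have z2 : 0 <= z.2 by [].
  move: lz => /(level_lineP _ xi_pos z1 z2)/=[/(_ i j) ge /(_ i j.-1) le].
  apply: leq_ltn_trans (ge _ _).
  - case: j le {sub ge z z1 z2} => [|j] le; first by rewrite height0r.
    by apply: le; rewrite ?ltr_nat // ltrDl.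
  - by rewrite -(natr1 i) ltrD2l; lra.
  - by rewrite ltr_nat.
case: j lth => [|j] lth; first by rewrite ltnn in lth.
exists (hammersley_height xi (i, j)) => -[x y] /= [/andP[ix xi1] ->].
apply/level_lineP => //=; first exact: le_trans ix.
split=> i' j' xi'; rewrite ltr_nat => jj'.
  apply: leq_trans lth _; apply: leq_height => //.
  by rewrite -ltnS -(ltr_nat R) (le_lt_trans ix).
by apply: leq_height => //; rewrite -ltnS -(ltr_nat R) (lt_le_trans xi').
Qed.

(** * The processing order *)

Definition next_vertex (v : nat * nat) : nat * nat :=
  if (v.1 <= 1)%N then (v.2.+1, 1%N) else (v.1.-1, v.2.+1).

Definition vertex (n : nat) : nat * nat := iter n next_vertex (1%N, 1%N).

Lemma vertex_gt0 n : positive_quadrant (vertex n).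
Proof.
elim: n => [|n] //; rewrite /vertex iterS -/(vertex n) /next_vertex.
case: (vertex n) => a b [/= a1 b1]; case: ltnP => //= lt1a; split=> //=.
by rewrite -ltnS prednK.
Qed.

(** The induction is on the antidiagonal: each one is entered at its bottom
    right end and walked up to the left. *)
Lemma vertex_surj v : positive_quadrant v -> exists n, v = vertex n.
Proof.
suff H k : forall i j, (i + j)%N = k -> exists n, (i.+1, j.+1) = vertex n.
  by case: v => -[|i] [|j] [] //= _ _; exact: (H _ i j erefl).
elim: k => [|k IHk] i j; first by case: i j => [|//] [|//] _; exists 0%N.
elim: j i => [|j IHj] i.
  rewrite addn0 => ->; have [n en] := IHk 0%N k (add0n k).
  by exists n.+1; rewrite /vertex iterS -/(vertex n) -en.
rewrite addnS -addSn => /IHj[n en].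
by exists n.+1; rewrite /vertex iterS -/(vertex n) -en.
Qed.

Lemma processed_before_next u v : positive_quadrant u -> positive_quadrant v ->
  processed_before u (next_vertex v) = processed_before u v || (u == v).
Proof.
case: u v => [a b] [i j] [/= a1 b1] [/= i1 j1].
rewrite /next_vertex /processed_before xpair_eqE /=; case: (leqP i 1) => /= i1'; lia.
Qed.

Section past.
Variables (Omega : Type) (X : Omega -> edge -> bool).

(** The first n vertices, [vertex 0] to [vertex n.-1], are those processed before
    [vertex n]. *)
Definition past (n : nat) (c : edge -> bool) : set Omega :=
  past_event X (vertex n).1 (vertex n).2 c.

Lemma past0 c : past 0 c = [set: Omega].
Proof.
apply/seteqP; split=> // w _ i j i1 j1; rewrite /processed_before /=; lia.
Qed.

Lemma pastS n c : past n.+1 c = past n c `&`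
  output_event X (vertex n).1 (vertex n).2
    (c (TopEdge (vertex n).1 (vertex n).2)) (c (RightEdge (vertex n).1 (vertex n).2)).
Proof.
have vn := vertex_gt0 n; rewrite /past {1 2}/vertex iterS -/(vertex n).
have E u : positive_quadrant u ->
    processed_before u ((next_vertex (vertex n)).1, (next_vertex (vertex n)).2) =
    processed_before u ((vertex n).1, (vertex n).2) || (u == vertex n).
  by move=> u0; rewrite -!surjective_pairing processed_before_next.
apply/seteqP; split=> w.
  move=> H; split; last first.
    by case: vn => v1 v2; apply: H; rewrite ?E -?surjective_pairing ?eqxx ?orbT.
  by move=> i j i1 j1 b; apply: H => //; rewrite E // b.
move=> [H [H1 H2]] i j i1 j1; rewrite E // => /orP[|/eqP e]; first exact: H.
by rewrite -[i]/(i, j).1 -[j in TopEdge _ j]/(i, j).2 -[j in RightEdge _ j]/(i, j).2 e.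
Qed.

Lemma subset_past m n c : (m <= n)%N -> past n c `<=` past m c.
Proof.
elim: n => [|n IHn]; first by rewrite leqn0 => /eqP ->.
rewrite leq_eqVlt ltnS => /predU1P[->//|/IHn]; rewrite pastS; exact: subset_trans.
Qed.

End past.

(** * Uniqueness in law of the CS6V model *)

Lemma measurable_edge d (Omega : measurableType d) (X : Omega -> edge -> bool)
  e b : (forall e, measurable [set w | X w e]) -> measurable [set w | X w e = b].
Proof.
move=> mX; case: b; first exact: mX.
rewrite (_ : [set _ | _] = ~` [set w | X w e]); first exact: measurableC.
by apply/seteqP; split=> w /= => [->|/negP/negbTE].
Qed.

Lemma measurable_output d (Omega : measurableType d) (X : Omega -> edge -> bool)
  i j top right : (forall e, measurable [set w | X w e]) ->
  measurable (output_event X i j top right).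
Proof.
move=> mX.
exact: measurableI (measurable_edge (TopEdge i j) top mX)
                   (measurable_edge (RightEdge i j) right mX).
Qed.

Lemma measurable_past d (Omega : measurableType d) (X : Omega -> edge -> bool)
  n c : (forall e, measurable [set w | X w e]) -> measurable (past X n c).
Proof.
move=> mX; elim: n => [|n IHn]; first by rewrite past0.
by rewrite pastS; apply: measurableI => //; exact: measurable_output.
Qed.

(** Every edge of the model is an output of some vertex, and the other edges are
    unoccupied, so any finite list of edges is decided by some finite past. *)
Lemma edges_in_past (s : seq edge) : exists n, forall f g : edge -> bool,
  empty_boundary f -> empty_boundary g -> past id n g f -> all f s = all g s.
Proof.
elim: s => [|e s [n Hn]]; first by exists 0%N.
suff [m Hm] : exists m, forall f g : edge -> bool,
    empty_boundary f -> empty_boundary g -> past id m g f -> f e = g e.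
  exists (maxn m n) => f g f0 g0 fg /=; congr (_ && _).
    by apply: Hm => //; apply: subset_past fg; exact: leq_maxl.
  by apply: Hn => //; apply: subset_past fg; exact: leq_maxr.
case: e => i j; have [b|] := boolP ((i == 0) || (j == 0))%N.
- by exists 0%N => f g /(_ _ _ b)[-> _] /(_ _ _ b)[-> _].
- rewrite negb_or -!lt0n => /andP ij.
  have [n' en] := @vertex_surj (i, j) ij.
  by exists n'.+1 => f g _ _; rewrite pastS -en => -[_ []].
- by exists 0%N => f g /(_ _ _ b)[_ ->] /(_ _ _ b)[_ ->].
- rewrite negb_or -!lt0n => /andP ij.
  have [n' en] := @vertex_surj (i, j) ij.
  by exists n'.+1 => f g _ _; rewrite pastS -en => -[_ []].
Qed.

(** The past of n + 1 vertices is indexed by a configuration; refining a past of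
    n vertices changes that configuration at [vertex n]. *)
Definition set_output (c : edge -> bool) (v : nat * nat) (top right : bool)
    (e : edge) : bool :=
  match e with
  | TopEdge i j => if (i, j) == v then top else c e
  | RightEdge i j => if (i, j) == v then right else c e
  end.

Lemma empty_boundary_set_output c v top right :
  positive_quadrant v -> empty_boundary c -> empty_boundary (set_output c v top right).
Proof.
case: v => a b [/= a1 b1] c0 i j ij; rewrite /= xpair_eqE.
have [-> ->] := c0 i j ij; case: eqP => //= ia; case: eqP => //= jb.
by move: ij; rewrite ia jb -(prednK a1) -(prednK b1).
Qed.

Lemma past_set_output (Omega : Type) (X : Omega -> edge -> bool) n c top right :
  past X n (set_output c (vertex n) top right) = past X n c.
Proof.
have E i j : processed_before (i, j) (vertex n) -> ((i, j) == vertex n) = false.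
  by apply: contraTF => /eqP ->; rewrite /processed_before; lia.
rewrite /past /past_event -surjective_pairing.
by apply/seteqP; split=> w /= H i j i1 j1 b; have := H i j i1 j1 b; rewrite /= E.
Qed.

Lemma past_setI_output (Omega : Type) (X : Omega -> edge -> bool) n c
    top right :
  past X n c `&` output_event X (vertex n).1 (vertex n).2 top right =
  past X n.+1 (set_output c (vertex n) top right).
Proof.
by rewrite pastS past_set_output /= -surjective_pairing eqxx.
Qed.

Lemma measure_split_output (R : realType) d (Omega : measurableType d)
    (P : {measure set Omega -> \bar R}) (X : Omega -> edge -> bool) i j
    (A : set Omega) :
  (forall e, measurable [set w | X w e]) -> measurable A ->
  P A = (\sum_(t : bool) \sum_(r : bool) P (A `&` output_event X i j t r))%E.
Proof.
move=> mX mA; rewrite !big_bool /=.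
have split_bool (B : set Omega) (e : edge) : measurable B ->
    P B = (P (B `&` [set w | X w e = true]) + P (B `&` [set w | X w e = false]))%E.
  move=> mB; rewrite (measureDI P mB (mX e)) addeC; congr (_ + P _)%E.
  by apply/seteqP; split=> w /= [Bw] => [/negP/negbTE|->].
have mX' e b : measurable [set w | X w e = b] by exact: measurable_edge.
rewrite (split_bool A (TopEdge i j)) //.
have splitR b := split_bool (A `&` [set w | X w (TopEdge i j) = b])
  (RightEdge i j) (measurableI _ _ mA (mX' _ b)).
by rewrite !splitR -!setIA.
Qed.

(** A finite past has for probability the product of the weights met on the
    way. *)
Lemma cs6v_past (R : realType) (b1 b2 : nat -> nat -> R) d d'
    (Omega : measurableType d) (P : probability Omega R)
    (Omega' : measurableType d') (P' : probability Omega' R)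
    (X : Omega -> edge -> bool) (Y : Omega' -> edge -> bool) n c :
  cs6v P b1 b2 X -> cs6v P' b1 b2 Y -> empty_boundary c ->
  P (past X n c) = P' (past Y n c).
Proof.
move=> [_ _ wX] [_ _ wY] c0; elim: n => [|n IHn].
  by rewrite !past0 !probability_setT.
have [v1 v2] := vertex_gt0 n.
by rewrite !pastS /past wX // wY // -!/(past _ _ _) IHn.
Qed.

(** Once the past decides the event, [cs6v_past] applies.  Shorter pasts are
    reached by backward induction, summing over the outputs of the next
    vertex. *)
Lemma cs6v_finite_event (R : realType) (b1 b2 : nat -> nat -> R) d d'
    (Omega : measurableType d) (P : probability Omega R)
    (Omega' : measurableType d') (P' : probability Omega' R)
    (X : Omega -> edge -> bool) (Y : Omega' -> edge -> bool) s :
  cs6v P b1 b2 X -> cs6v P' b1 b2 Y ->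
  P [set w | all (X w) s] = P' [set w | all (Y w) s].
Proof.
move=> cX cY; have [mX X0 _] := cX; have [mY Y0 _] := cY.
have [N HN] := edges_in_past s.
have mall d0 (T : measurableType d0) (Z : T -> edge -> bool) :
    (forall e, measurable [set w | Z w e]) -> measurable [set w | all (Z w) s].
  move=> mZ; elim: (s) => [|e s' IH] /=.
    by rewrite (_ : [set _ | _] = [set: T]); [exact: measurableT|exact/seteqP].
  rewrite (_ : [set _ | _] = [set w | Z w e] `&` [set w | all (Z w) s']); last first.
    by apply/seteqP; split=> w /= => [/andP|[-> ->]].
  exact: measurableI.
suff H k n c : (n + k)%N = N -> empty_boundary c ->
    P (past X n c `&` [set w | all (X w) s]) = P' (past Y n c `&` [set w | all (Y w) s]).
  have := H N 0%N (fun=> false) (add0n N) (fun _ _ _ => conj erefl erefl).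
  by rewrite !past0 !setTI.
elim: k n c => [|k IHk] n c nN c0.
  (* The outputs of the first N vertices are those of c, which decides s. *)
  have E T (Z : T -> edge -> bool) : (forall w, empty_boundary (Z w)) ->
      past Z n c `&` [set w | all (Z w) s] = if all c s then past Z n c else set0.
    move=> Z0; move: nN; rewrite addn0 => ->.
    have HZ w : past Z N c w -> all (Z w) s = all c s by exact: HN.
    case: ifP => cs.
      by apply/seteqP; split=> w => [[]//|pw]; split=> //=; rewrite HZ.
    by rewrite -subset0 => w [pw] /=; rewrite HZ // cs.
  by rewrite !E //; case: ifP => _; [exact: cs6v_past cX cY c0|rewrite !measure0].
rewrite (measure_split_output P (vertex n).1 (vertex n).2 mX); last first.
  by apply: measurableI; [exact: measurable_past|exact: mall].
rewrite (measure_split_output P' (vertex n).1 (vertex n).2 mY); last first.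
  by apply: measurableI; [exact: measurable_past|exact: mall].
apply: eq_bigr => t _; apply: eq_bigr => r _.
rewrite (setIAC (past X n c)) (setIAC (past Y n c)) !past_setI_output.
apply: IHk; first by rewrite addSnnS.
exact: empty_boundary_set_output (vertex_gt0 n) c0.
Qed.

Lemma product_space_measurable_coordinate (I : Type) d (V : measurableType d) (i : I) :
  measurable_fun [set: product_space I V] (fun f : I -> V => f i).
Proof.
by move=> _ B mB; apply: sub_sigma_algebra; exists i => //; exists B.
Qed.

Lemma measurable_product_space (I : Type) d (V : measurableType d) d'
    (T : measurableType d') (Z : T -> I -> V) :
  (forall i, measurable_fun [set: T] (fun w => Z w i)) ->
  measurable_fun [set: T] (Z : T -> product_space I V).
Proof.
move=> mZ; apply: (@measurability _ _ T (product_space I V) setT Z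
  (\bigcup_(i in [set: I])
    preimage_set_system [set: I -> V] (fun f : I -> V => f i) measurable)) => //.
move=> _ [_ [i _ [B mB <-]] <-].
by rewrite setTI preimage_setI preimage_setT setTI -[X in measurable X]setTI; exact: mZ.
Qed.

Lemma measurable_edge_config d (T : measurableType d) (Z : T -> edge -> bool) :
  (forall e, measurable [set w | Z w e]) ->
  measurable_fun [set: T] (Z : T -> product_space edge bool).
Proof.
move=> mZ; apply: measurable_product_space => e.
by apply: (measurable_fun_bool true); rewrite setTI; exact: mZ.
Qed.

(** The finite intersections of the events that a coordinate is true form a
    pi-system; the complements come with the sigma-algebra. *)
Lemma product_space_boolE (I : Type) :
  @measurable _ (product_space I bool) =
  <<s [set [set f : I -> bool | all f s] | s in [set: seq I]] >>.
Proof.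
set G := [set _ | _ in _]; apply/seteqP; split.
  apply: smallest_sub; first exact: smallest_sigma_algebra.
  move=> _ [i _ [B mB <-]].
  have mi : measurable_fun [set: g_sigma_algebraType G] (fun f : I -> bool => f i).
    apply: (measurable_fun_bool true); rewrite setTI; apply: sub_sigma_algebra.
    by exists [:: i] => //; apply/seteqP; split=> f /=; rewrite andbT.
  exact: mi.
apply: smallest_sub; first exact: sigma_algebra_measurable.
move=> _ [s _ <-]; elim: s => [|i s IHs] /=.
  rewrite (_ : [set _ | _] = [set: product_space I bool]).
    exact: measurableT.
  exact/seteqP.
rewrite (_ : [set _ | _] =
    [set f : product_space I bool | f i = true] `&` [set f | all f s]).
  apply: measurableI => //.
  rewrite -[X in measurable X]setTI.
  exact: (@product_space_measurable_coordinate _ _ bool i measurableT [set true]).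
by apply/seteqP; split=> f /= => [/andP|[-> ->]].
Qed.

Lemma cs6v_unique (R : realType) (b1 b2 : nat -> nat -> R) d d'
    (Omega : measurableType d) (P : probability Omega R)
    (Omega' : measurableType d') (P' : probability Omega' R)
    (X : Omega -> edge -> bool) (Y : Omega' -> edge -> bool) :
  cs6v P b1 b2 X -> cs6v P' b1 b2 Y ->
  same_distribution P P' (E := product_space edge bool) X Y.
Proof.
move=> cX cY; have [mX _ _] := cX; have [mY _ _] := cY.
have mfX := measurable_edge_config mX; have mfY := measurable_edge_config mY.
split=> // A mA.
apply: (measure_unique _ (fun=> setT) (product_space_boolE edge)) => //.
- by move=> _ _ [s _ <-] [t _ <-]; exists (s ++ t) => //; apply/seteqP;
     split=> f /=; rewrite all_cat; [move/andP|move=> [-> ->]].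
- by move=> i; exists [::] => //; exact/seteqP.
- exact: bigcup_const.
- by move=> _ [s _ <-]; exact: cs6v_finite_event cX cY.
- by move=> k; apply: le_lt_trans (probability_le1 _ _) (ltry _); rewrite preimage_setT.
Qed.

(** * The level lines as a CS6V model *)

(** The sum of the increments of the height along a row telescopes. *)
Lemma cs6v_height_level_lines (R : realType) (xi : set (nat * nat)) :
  xi `<=` positive_quadrant ->
  cs6v_height (level_line_edges R xi) = hammersley_height xi.
Proof.
move=> xi_pos; apply/funext => -[x y]; rewrite /cs6v_height /=.
case: eqP => [->|_]; first by rewrite height0r.
elim: x => [|x IHx]; first by rewrite big_geq // height0l.
rewrite big_nat_recr //= IHx level_line_edges_top //=.
have := heightSl xi x.+1 y; have := leq_height xi (leqnSn x) (leqnn y); rewrite /=.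
by case: ltnP => /=; lia.
Qed.

Lemma level_line_edges_empty (R : realType) (xi : set (nat * nat)) :
  xi `<=` positive_quadrant -> empty_boundary (level_line_edges R xi).
Proof.
move=> xi_pos i j ij; rewrite level_line_edges_top // level_line_edges_right //.
by move: ij => /orP[] /eqP ->; rewrite ?height0l ?height0r.
Qed.

(** A case analysis on the two incoming increments in [heightSS]. *)
Lemma level_line_edges_vertex (R : realType) (xi : set (nat * nat)) i j :
  xi `<=` positive_quadrant -> (1 <= i)%N -> (1 <= j)%N ->
  let bottom := level_line_edges R xi (TopEdge i j.-1) in
  let left := level_line_edges R xi (RightEdge i.-1 j) in
  level_line_edges R xi (TopEdge i j) =
    (if bottom == left then ~~ bottom && `[< xi (i, j) >] else bottom) /\
  level_line_edges R xi (RightEdge i j) =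
    (if bottom == left then ~~ left && `[< xi (i, j) >] else left).
Proof.
case: i j => [//|i] [//|j] xi_pos _ _ /=.
rewrite !level_line_edges_top // !level_line_edges_right //= heightSS.
have := leq_height xi (leqnSn i) (leqnn j); have := leq_height xi (leqnn i) (leqnSn j).
have := heightSl xi i.+1 j; have := heightSr xi i j.+1 => /=.
move: (hammersley_height xi (i, j.+1)) (hammersley_height xi (i.+1, j)) => a b.
move: (hammersley_height xi (i, j)) => D => hDb hDa haD hbD.
by case: (ltnP D b) => Db; case: (ltnP D a) => Da; case: `[< _ >] => /=; lia.
Qed.

(** The recursion [heightSS] only involves maxima, sums and finitely many points.
    The measurable space is arbitrary, so that the lemma also applies to the
    sigma-algebra of the field away from a vertex. *)
Lemma measurable_height d (T : measurableType d) (xi : T -> set (nat * nat)) :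
  (forall v, positive_quadrant v -> measurable [set w | xi w v]) ->
  forall v, measurable_fun [set: T] (fun w => hammersley_height (xi w) v).
Proof.
move=> mxi [i j]; elim: i j => [|i IHi] j.
  by rewrite (_ : (fun _ => _) = cst 0%N) //; apply/funext => w; rewrite height0l.
elim: j => [|j IHj].
  by rewrite (_ : (fun _ => _) = cst 0%N) //; apply/funext => w; rewrite height0r.
under eq_fun do rewrite heightSS.
apply: measurable_realfun.measurable_fun_maxn.
  exact: measurable_realfun.measurable_fun_maxn.
apply: measurable_realfun.measurable_fun_addn => //; apply: measurable_fun_ifT => //.
apply: (measurable_fun_bool true); rewrite setTI.
rewrite (_ : _ @^-1` _ = [set w | xi w (i.+1, j.+1)]); first exact: mxi.
by apply/seteqP; split=> w /= /asboolP.
Qed.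

Lemma measurable_level_line_edges (R : realType) d (T : measurableType d)
    (xi : T -> set (nat * nat)) :
  (forall w, xi w `<=` positive_quadrant) ->
  (forall v, positive_quadrant v -> measurable [set w | xi w v]) ->
  forall e, measurable [set w | level_line_edges R (xi w) e].
Proof.
move=> xi_pos mxi e; have mh := measurable_height mxi.
have mlt u v : measurable
    [set w | (hammersley_height (xi w) u < hammersley_height (xi w) v)%N].
  rewrite -[X in measurable X]setTI.
  exact: (measurable_realfun.measurable_fun_ltn
           (mh u) (mh v) measurableT (Y := [set true])).
case: e => i j.
  by under eq_set do rewrite level_line_edges_top //; exact: mlt.
by under eq_set do rewrite level_line_edges_right //; exact: mlt.
Qed.

Section bernoulli.
Variables (R : realType) (p : R) (d : measure_display) (Omega : measurableType d).
Variables (P : probability Omega R) (xi : Omega -> set (nat * nat)).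
Hypotheses (p0 : 0 <= p) (hxi : bernoulli_field P p xi).

Let xi_pos w : xi w `<=` positive_quadrant. Proof. by case: hxi. Qed.

Let mxi v : positive_quadrant v -> measurable [set w | xi w v].
Proof. by case: hxi => _ + _ v0 => /(_ _ v0)[]. Qed.

Definition all_occupied (s : seq (nat * nat)) : set Omega :=
  \bigcap_(v in [set` s]) [set w | xi w v].

(** A pi-system that generates the events that depend on the field away from
    [v0]. *)
Definition occupied_off (v0 : nat * nat) : set (set Omega) :=
  [set all_occupied s | s in [set s | [set` s] `<=` positive_quadrant `\ v0]].

Lemma measurable_all_occupied s :
  [set` s] `<=` positive_quadrant -> measurable (all_occupied s).
Proof.
move=> s_pos; apply: fin_bigcap_measurable => [|v vs]; first exact: finite_seq.
by apply: mxi; exact: s_pos.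
Qed.

(** On the pi-system this is the product rule.  It extends to the generated
    sigma-algebra, since both sides are finite measures of A. *)
Lemma bernoulli_independent v0 (A : set Omega) : positive_quadrant v0 ->
  <<s occupied_off v0 >> A -> P (A `&` [set w | xi w v0]) = (P A * p%:E)%E.
Proof.
move=> v0_pos sA.
have offS s : [set` s] `<=` positive_quadrant `\ v0 ->
    [set` s] `<=` positive_quadrant.
  by move=> sub v /sub[].
have mV : measurable [set w | xi w v0] by exact: mxi.
have occT : all_occupied [::] = [set: Omega] by rewrite /all_occupied set_nil bigcap_set0.
have offT : occupied_off v0 [set: Omega] by exists [::] => // v.
rewrite muleC.
suff : mrestr P mV A = mscale (NngNum p0) P A by [].
apply: (@g_sigma_algebra_measure_unique _ _ _ (occupied_off v0) _ (fun=> setT)) => //.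
- by move=> _ [s /offS s_pos <-]; exact: measurable_all_occupied.
- exact: bigcup_const.
- move=> _ _ [s sv0 <-] [t tv0 <-]; exists (s ++ t).
    by move=> v /=; rewrite mem_cat => /orP[/sv0|/tv0].
  rewrite /all_occupied -bigcap_setU; congr bigcap.
  by apply/seteqP; split=> v /=; rewrite mem_cat => /orP.
- move=> _ [s sv0 <-].
  change (P (all_occupied s `&` [set w | xi w v0]) = p%:E * P (all_occupied s))%E.
  have occE : all_occupied s = all_occupied (undup s).
    by rewrite /all_occupied; congr bigcap; apply/seteqP; split=> v /=; rewrite mem_undup.
  have [_ pxi indep] := hxi.
  have us : uniq (v0 :: undup s).
    by rewrite /= undup_uniq andbT mem_undup; apply/negP => /sv0[_]; apply.
  have v0s_pos : [set` v0 :: undup s] `<=` positive_quadrant.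
    by move=> v /=; rewrite inE mem_undup => /predU1P[->//|/sv0[]].
  have -> : all_occupied s `&` [set w | xi w v0] = all_occupied (v0 :: undup s).
    rewrite occE /all_occupied setIC; apply/seteqP; split=> w.
      by move=> [wv0 ws] v /=; rewrite inE => /predU1P[->//|/ws].
    move=> ws; split; first by apply: (ws v0); rewrite /= mem_head.
    by move=> v vs; apply: ws; rewrite /= inE vs orbT.
  rewrite indep // big_cons (pxi v0 v0_pos).2 occE indep //.
    by case/andP: us.
  by move=> v vs; apply: v0s_pos; rewrite /= inE vs orbT.
- by move=> k; rewrite /mrestr (le_lt_trans (probability_le1 _ _)) ?ltry // setTI.
Qed.

(** Deleting [vertex n] from the field does not alter the heights at the
    corners of the edges processed before it, for that vertex lies in none of
    their boxes. *)
Lemma past_off_vertex n c :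
  <<s occupied_off (vertex n) >>
    (past (fun w => level_line_edges R (xi w)) n c).
Proof.
pose xi' w := xi w `\ vertex n.
have xi'_pos w : xi' w `<=` positive_quadrant by move=> v [/xi_pos].
have -> : past (fun w => level_line_edges R (xi w)) n c =
          past (fun w => level_line_edges R (xi' w)) n c.
  have E w i j : processed_before (i, j) (vertex n) ->
      forall e, e = TopEdge i j \/ e = RightEdge i j ->
      level_line_edges R (xi w) e = level_line_edges R (xi' w) e.
    move=> b; have eh x y : (x <= i)%N -> (y <= j)%N ->
        hammersley_height (xi w) (x, y) = hammersley_height (xi' w) (x, y).
      move=> xi0 yj; apply: eq_height => v vx vy; split=> [xiv|[]//].
      split=> //= ev; move: b; rewrite -ev /processed_before /=; lia.
    by move=> e [] ->; rewrite ?level_line_edges_top ?level_line_edges_right //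
      !eh // leq_pred.
  rewrite /past /past_event -surjective_pairing.
  by apply/seteqP; split=> w /= H i j i1 j1 b; have := H i j i1 j1 b;
    have Eb := E w i j b; rewrite !Eb; auto.
apply: (@measurable_past _ (g_sigma_algebraType (occupied_off (vertex n)))).
apply: measurable_level_line_edges => // v v_pos.
(* The deleted point is absent for sure; the others generate. *)
have [->|vn] := eqVneq v (vertex n).
  rewrite (_ : [set w | _] = set0); first exact: measurable0.
  by rewrite -subset0 => w [_ []].
apply: sub_sigma_algebra; exists [:: v].
  by move=> u /=; rewrite inE => /eqP ->; split=> //=; exact/eqP.
rewrite /all_occupied; apply/seteqP; split=> w /=.
  by move=> /(_ v (mem_head _ _)) wv; split=> //=; exact/eqP.
by move=> [wv _] u /=; rewrite inE => /eqP ->.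
Qed.

(** On a past with inputs B and L the outputs are determined, unless no line
    comes in; then they tell whether the vertex belongs to the field; the
    independence of the past then gives the weights p and 1 - p. *)
Lemma hammersley_cs6v :
  cs6v P (fun _ _ => 0) (fun _ _ => 1 - p) (fun w => level_line_edges R (xi w)).
Proof.
set Z := fun w => level_line_edges R (xi w).
have mZ e : measurable [set w | Z w e] by exact: measurable_level_line_edges.
have Z0 w : empty_boundary (Z w) by exact: level_line_edges_empty.
split=> // i j i1 j1 c c0 t r.
have [n en] := @vertex_surj (i, j) (conj i1 j1).
have pastE : past_event Z i j c = past Z n c by rewrite /past -en.
have sA := @past_off_vertex n c; have mA := @measurable_past _ _ Z n c mZ.
rewrite pastE; set A := past Z n c in sA mA *.
have ij_pos : positive_quadrant (i, j) by [].
have mV := mxi ij_pos; set V := [set w | xi w (i, j)] in mV.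
have PV : P (A `&` V) = (P A * p%:E)%E.
  by apply: bernoulli_independent => //; rewrite en.
have PVc : P (A `\` V) = (P A * (1 - p)%:E)%E.
  rewrite measureD //; last exact: le_lt_trans (probability_le1 _ mA) (ltry _).
  rewrite [X in (_ - X)%E]PV EFinB muleBr ?mule1 //; exact: fin_num_measure.
set B := c (TopEdge i j.-1); set L := c (RightEdge i.-1 j).
have AB w : A w -> Z w (TopEdge i j.-1) = B /\ Z w (RightEdge i.-1 j) = L.
  move=> wA; have Aw : past_event Z i j c w by rewrite pastE.
  split.
    (* An input on the boundary is not in the past, but is unoccupied. *)
    case: (posnP j.-1) => [j0|j0].
      have b : (i == 0)%N || (j.-1 == 0)%N by rewrite j0 orbT.
      by rewrite /B (Z0 w _ _ b).1 (c0 _ _ b).1.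
    by apply: (Aw i j.-1 i1 j0 _).1; rewrite /processed_before /=; lia.
  case: (posnP i.-1) => [i0|i0].
    have b : (i.-1 == 0)%N || (j == 0)%N by rewrite i0.
    by rewrite /L (Z0 w _ _ b).2 (c0 _ _ b).2.
  by apply: (Aw i.-1 j i0 j1 _).2; rewrite /processed_before /=; lia.
have out w : A w ->
    Z w (TopEdge i j) = (if B == L then ~~ B && `[< V w >] else B) /\
    Z w (RightEdge i j) = (if B == L then ~~ L && `[< V w >] else L).
  move=> /AB[<- <-]; exact: level_line_edges_vertex.
have PI (S : set Omega) : (forall w, A w -> output_event Z i j t r w <-> S w) ->
    P (A `&` output_event Z i j t r) = P (A `&` S).
  move=> OS; congr (P _); apply/seteqP; split=> w [Aw Ow]; split=> //; exact/OS.
have Pconst (b : bool) : (forall w, A w -> output_event Z i j t r w <-> b) ->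
    P (A `&` output_event Z i j t r) = (P A * (b%:R)%:E)%E.
  move=> Ob; rewrite (PI [set w | b]) //; case: (b).
    by rewrite (_ : [set _ | _] = setT) ?setIT ?mule1 //; exact/seteqP.
  by rewrite (_ : [set _ | _] = set0) ?setI0 ?measure0 ?mule0 //; apply/seteqP; split.
have det (t' r' : bool) :
    (forall w, A w -> Z w (TopEdge i j) = t' /\ Z w (RightEdge i j) = r') ->
    P (A `&` output_event Z i j t r) = (P A * ((t' == t) && (r' == r))%:R%:E)%E.
  move=> H; apply: Pconst => w /H[e1 e2]; rewrite /output_event /= e1 e2; split.
    by move=> [-> ->]; rewrite !eqxx.
  by move=> /andP[/eqP -> /eqP ->].
move: out; rewrite /cs6v_weight; case: B L {AB} => [] [] /= out.
- rewrite (det false false out); congr (_ * _%:E)%E.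
  case: t r {PI Pconst det out} => [] [] //=.
  by rewrite subr0.
- exact: det true false out.
- exact: det false true out.
- case: t r {Pconst det} PI => [] [] PI /=.
  + rewrite (PI V); first by rewrite PV subKr.
    by move=> w /out[e1 e2]; rewrite /output_event /= e1 e2; split=> [[/asboolP]|/asboolP].
  + rewrite (PI set0) ?setI0 ?measure0 ?mule0 // => w /out[e1 e2].
    by rewrite /output_event /= e1 e2; split=> // -[->].
  + rewrite (PI set0) ?setI0 ?measure0 ?mule0 // => w /out[e1 e2].
    by rewrite /output_event /= e1 e2; split=> // -[->].
  + rewrite (PI (~` V)) // => w /out[e1 e2]; rewrite /output_event /= e1 e2.
    by split=> [[/asboolPn]|/asboolPn/negbTE ->].
Qed.

End bernoulli.

(** * Equality in law *)

Lemma measurable_cs6v_height :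
  measurable_fun [set: product_space edge bool]
    (cs6v_height : product_space edge bool -> product_space (nat * nat)%type nat).
Proof.
apply: measurable_product_space => -[x y]; rewrite /cs6v_height /=.
case: (y == 0)%N; first exact: measurable_cst.
elim: x => [|x IHx].
  by rewrite (_ : (fun _ => _) = cst 0%N) //; apply/funext => c; rewrite big_geq.
rewrite (_ : (fun _ => _) = (fun c : edge -> bool =>
  \sum_(1 <= z < x.+1) c (TopEdge z y) + c (TopEdge x.+1 y))%N); last first.
  by apply/funext => c; rewrite big_nat_recr.
apply: measurable_realfun.measurable_fun_addn => //; apply: measurable_fun_ifT => //.
exact: product_space_measurable_coordinate.
Qed.

Lemma same_distribution_comp (R : realType) d d' d1 d2
    (Omega : measurableType d) (P : probability Omega R)
    (Omega' : measurableType d') (P' : probability Omega' R)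
    (E : measurableType d1) (F : measurableType d2)
    (X : Omega -> E) (Y : Omega' -> E) (g : E -> F) :
  measurable_fun [set: E] g -> same_distribution P P' X Y ->
  same_distribution P P' (g \o X) (g \o Y).
Proof.
move=> mg [mX mY eXY]; split.
- exact: measurableT_comp.
- exact: measurableT_comp.
- move=> A mA; apply: (eXY (g @^-1` A)).
  by rewrite -[X in measurable X]setTI; exact: mg.
Qed.

Theorem theorem1p6 (R : realType) (p : R) (hp : 0 <= p <= 1)
    (d d' : measure_display)
    (Omega : measurableType d) (P : probability Omega R)
    (Omega' : measurableType d') (P' : probability Omega' R)
    (X : Omega -> edge -> bool) (xi : Omega' -> set (nat * nat))
    (hX : cs6v P (fun _ _ => 0) (fun _ _ => 1 - p) X)
    (hxi : bernoulli_field P' p xi) :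
  same_distribution P P' (E := product_space edge bool)
    X (fun w => level_line_edges R (xi w)) /\
  same_distribution P P' (E := product_space (nat * nat)%type nat)
    (fun w => cs6v_height (X w)) (fun w => hammersley_height (xi w)).
Proof.
have [p0 _] := andP hp.
have edges_law := cs6v_unique hX (hammersley_cs6v p0 hxi).
split=> //; have [xi_pos _ _] := hxi.
rewrite (_ : (fun w => hammersley_height (xi w)) =
  (fun w => cs6v_height (level_line_edges R (xi w)))).
  exact: same_distribution_comp measurable_cs6v_height edges_law.
by apply/funext => w; rewrite cs6v_height_level_lines.
Qed.
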